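(* The set $Z$ satisfies $$Z=\left\{x\in\mathbb{R}^n:\ \frac{\delta}{\epsilon}+\mathrm{CVaR}_{1-\epsilon}\left[-f(x,\tilde\zeta)\right]\le0\right\},$$ where $$\mathrm{CVaR}_{1-\epsilon}\left[-f(x,\tilde\zeta)\right]=\min_{\gamma}\left\{\gamma+\frac1\epsilon\,\mathbb{E}_{\mathbb{P}_{\tilde\zeta}}\left[-f(x,\tilde\zeta)-\gamma\right]_+\right\}.$$
   Context: Let $n,I,N$ be positive integers, $[R]:=\{1,\dots,R\}$, $\epsilon\in(0,1)$, $\delta>0$. Let $\eta_1,\eta_2\in\{0,1\}$ with $\eta_1+\eta_2\ge1$. For $x\in\mathbb{R}^n$ let $a(x)=\begin{pmatrix}\eta_1x\\ \eta_2\end{pmatrix}\in\mathbb{R}^{n+1}$ and, for $i\in[I]$, $b_i(x)=B_i^\top x+b^i$ with given $B_i\in\mathbb{R}^n$, $b^i\in\mathbb{R}$. The uncertain parameter $\xi=(\xi_1,\dots,\xi_I)$, $\xi_i\in\mathbb{R}^{n+1}$, takes values in $\Xi=\mathbb{R}^{I\times(n+1)}$, equipped with a norm $\|\cdot\|$. For $a\in\mathbb{R}^{n+1}$ the dual norm is $\|a\|_*=\sup\{a^\top u_i:\ u=(u_1,\dots,u_I)\in\Xi,\ \|u\|\le1\}$, where the norm is such that this value does not depend on $i\in[I]$ (as for any $L_p$ norm). Samples $\zeta^1,\dots,\zeta^N\in\Xi$, $\zeta^j=(\zeta^j_1,\dots,\zeta^j_I)$, are given (realizations of i.i.d. samples from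 a true distribution); the random vector $\tilde\zeta$ has the empirical distribution $\mathbb{P}_{\tilde\zeta}$, which gives mass $1/N$ to each $\zeta^j$, $j\in[N]$. The Wasserstein distance of probability distributions on $\Xi$ is $$W(\mathbb{P}_1,\mathbb{P}_2)=\inf\left\{\int_{\Xi\times\Xi}\|\xi_1-\xi_2\|\,\mathbb{Q}(d\xi_1,d\xi_2):\ \mathbb{Q}\text{ a joint distribution with marginals }\mathbb{P}_1,\mathbb{P}_2\right\},$$ and the ambiguity set is $\mathcal{P}=\{\mathbb{P}:\ \mathbb{P}\{\tilde\xi\in\Xi\}=1,\ W(\mathbb{P},\mathbb{P}_{\tilde\zeta})\le\delta\}$. Define $$Z=\left\{x\in\mathbb{R}^n:\ \inf_{\mathbb{P}\in\mathcal{P}}\mathbb{P}\left\{\tilde\xi:\ a(x)^\top\tilde\xi_i\le b_i(x),\ \forall i\in[I]\right\}\ge1-\epsilon\right\}.$$ The function $f$ is $$f(x,\zeta)=\min\left\{\min_{i\in[I]\setminus\mathcal{I}(x)}\frac{\max\{b_i(x)-a(x)^\top\zeta_i,\,0\}}{\|a(x)\|_*},\ \min_{i\in\mathcal{I}(x)}\chi_{\{x:\,b_i(x)<0\}}(x)\right\}\in[0,+\infty],$$ with $\mathcal{I}(x)=\emptyset$ if $a(x)\ne0$ and $\mathcal{I}(x)=[I]$ otherwise, $\chi_R(x)=0$ if $x\in R$ and $\infty$ otherwise, and a minimum over the empty set equal to $+\infty$. Here $t_+=\max\{t,0\}$, $(-\infty)_+=0$, and the minimum over $\gamma\in\mathbb{R}$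 is read as $-\infty$ when the expression is unbounded below. *)

(* Defs.v *)
From HB Require Import structures.
From mathcomp Require Import all_boot all_order all_algebra.
From mathcomp Require Import all_classical all_reals all_analysis.
Set Implicit Arguments.
Unset Strict Implicit.
Unset Printing Implicit Defensive.
Import Order.TTheory GRing.Theory Num.Theory.
Import numFieldNormedType.Exports.
Local Open Scope classical_set_scope.
Local Open Scope ring_scope.

(* The space R^(I x (n+1)) with the Borel sigma-algebra of its usual topology
   (which is the topology of every norm); xi_i is the i-th row. *)
Definition Xi (R : realType) (I n : nat) :=
  g_sigma_algebraType (@open 'M[R]_(I, n + 1)).

HB.instance Definition _ (R : realType) (I n : nat) :=
  Measurable.on (Xi R I n).

Record is_norm (R : realType) (V : lmodType R) (nrm : V -> R) : Prop := {
  norm_triangle : forall u v, nrm (u + v) <= nrm u + nrm v;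
  norm_homogeneous : forall (c : R) u, nrm (c *: u) = `|c| * nrm u;
  norm_definite : forall u, nrm u = 0 -> u = 0
}.

Definition dot (R : realType) (k : nat) (u v : 'cV[R]_k) : R :=
  \sum_(j < k) u j 0 * v j 0.

Definition block (R : realType) (I n : nat) (xi : 'M[R]_(I, n + 1))
  (i : 'I_I) : 'cV[R]_(n + 1) := (row i xi)^T.

(* The value of the dual norm computed with the i-th block; norms for which it
   depends on i have to be excluded where a single dual norm is meant. *)
Definition dual_norm (R : realType) (I n : nat) (nrm : 'M[R]_(I, n + 1) -> R)
    (i : 'I_I) (a : 'cV[R]_(n + 1)) : R :=
  sup [set dot a (block u i) | u in [set u | nrm u <= 1]].

Definition avec (R : realType) (n : nat) (eta1 eta2 : bool) (x : 'cV[R]_n) :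
    'cV[R]_(n + 1) :=
  col_mx (eta1%:R *: x) (const_mx eta2%:R).

Definition bfun (R : realType) (I n : nat) (B : 'I_I -> 'cV[R]_n)
    (b : 'I_I -> R) (i : 'I_I) (x : 'cV[R]_n) : R :=
  dot (B i) x + b i.

Section empirical.
Context (d : measure_display) (T : measurableType d) (R : realType).
Variables (N : nat) (N_gt0 : (0 < N)%N) (zeta : 'I_N -> T).

(* [N_gt0] is only used to make this a probability measure. *)
Definition empirical of (0 < N)%N : set T -> \bar R := fun A =>
  (N%:R^-1%:E * \sum_(j < N) \d_(zeta j) A)%E.

Local Notation mu := (empirical N_gt0).

Let empirical0 : mu set0 = 0%E.
Proof. by rewrite /empirical big1 ?mule0// => j _; rewrite measure0. Qed.

Let empirical_ge0 A : (0 <= mu A)%E.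
Proof.
apply: mule_ge0; first by rewrite lee_fin invr_ge0 ler0n.
by apply: sume_ge0 => j _; exact: measure_ge0.
Qed.

Let empirical_semi_sigma_additive : semi_sigma_additive mu.
Proof.
move=> F mF tF mUF.
rewrite [X in X @ _ --> _](_ : _ = (fun n =>
  N%:R^-1%:E * \sum_(j < N) \sum_(0 <= i < n) \d_(zeta j) (F i)))%E; last first.
  apply/funext => n; rewrite exchange_big/= ge0_sume_distrr// => i _.
  by apply: sume_ge0 => j _; exact: measure_ge0.
apply: cvgeZl => //; apply: cvg_nnesum => j _.
- by apply: nearW => n; apply: sume_ge0 => i _; exact: measure_ge0.
- exact: measure_semi_sigma_additive.
Qed.

HB.instance Definition _ := isMeasure.Build _ _ _ mu
  empirical0 empirical_ge0 empirical_semi_sigma_additive.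

Let empirical_setT : mu setT = 1%E.
Proof.
rewrite /empirical (eq_bigr (fun=> 1%:E)) => [|j _]; last by rewrite diracT.
rewrite sumEFin sumr_const card_ord -EFinM mulVf//.
by rewrite pnatr_eq0 -lt0n.
Qed.

HB.instance Definition _ := Measure_isProbability.Build _ _ _ mu empirical_setT.

End empirical.

Section wasserstein.
Context (R : realType) (I n : nat).
Variable nrm : 'M[R]_(I, n + 1) -> R.
Local Notation Xi := (Xi R I n).

Definition coupling (P1 P2 : probability Xi R)
    (Q : probability (Xi * Xi)%type R) : Prop :=
  forall A : set Xi, measurable A ->
    Q (fst @^-1` A) = P1 A /\ Q (snd @^-1` A) = P2 A.

Definition wasserstein (P1 P2 : probability Xi R) : \bar R :=
  ereal_inf [set (\int[Q]_p
      (nrm ((p.1 : 'M[R]_(I, n + 1)) - (p.2 : 'M[R]_(I, n + 1))))%:E)%E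
    | Q in coupling P1 P2].

(* P(Xi) = 1 is part of the type of P. *)
Definition ambiguity (P0 : probability Xi R) (delta : R) :
    set (probability Xi R) :=
  [set P | (wasserstein P P0 <= delta%:E)%E].

End wasserstein.

Section chance_constraint.
Context (R : realType) (I n : nat).
Variable nrm : 'M[R]_(I, n + 1) -> R.
Variables (eta1 eta2 : bool) (B : 'I_I -> 'cV[R]_n) (b : 'I_I -> R).
Local Notation Xi := (Xi R I n).
Local Notation a := (avec eta1 eta2).
Local Notation b_ := (bfun B b).

Definition safe (x : 'cV[R]_n) : set Xi :=
  [set xi | forall i : 'I_I, dot (a x) (block xi i) <= b_ i x].

Definition Zset (P0 : probability Xi R) (delta eps : R) : set 'cV[R]_n :=
  [set x | ((1 - eps)%:E <=
    ereal_inf [set P (safe x) | P in ambiguity nrm P0 delta])%E].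

Definition calI (x : 'cV[R]_n) : {set 'I_I} :=
  if a x == 0 then [set: 'I_I]%SET else finset.set0.

Definition chi (S : set 'cV[R]_n) (x : 'cV[R]_n) : \bar R :=
  if x \in S then 0%E else +oo%E.

Definition f (x : 'cV[R]_n) (zeta : Xi) : \bar R :=
  mine
    (\big[mine/+oo%E]_(i | i \notin calI x)
       (Num.max (b_ i x - dot (a x) (block zeta i)) 0
          / dual_norm nrm i (a x))%:E)
    (\big[mine/+oo%E]_(i in calI x) chi [set y | b_ i y < 0] x).

End chance_constraint.

Section cvar.
Context (d : measure_display) (T : measurableType d) (R : realType).
Variables (P : probability T R) (eps : R) (X : T -> \bar R).

Definition cvar_objective (gamma : R) : \bar R :=
  (gamma%:E + eps^-1%:E * \int[P]_w maxe (X w - gamma%:E) 0)%E.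

(* CVaR at level 1 - eps.  The values of the objective are never -oo, so the
   infimum is -oo exactly when the objective is unbounded below. *)
Definition cvar : \bar R := ereal_inf (range cvar_objective).

End cvar.

(* Main.v *)
Require Import Defs.
From HB Require Import structures.
From mathcomp Require Import all_boot all_order all_algebra.
From mathcomp Require Import all_classical all_reals all_analysis.
From mathcomp Require Import measurable_realfun ring lra.
Set Implicit Arguments.
Unset Strict Implicit.
Unset Printing Implicit Defensive.
Import Order.TTheory GRing.Theory Num.Theory.
Import numFieldNormedType.Exports.
Local Open Scope classical_set_scope.
Local Open Scope ring_scope.

(** Fix a decision [x] and write [a] for [avec eta1 eta2 x].  Suppose first that
    [a] is nonzero.  Then [f x z] is the distance, in the norm [nrm], from [z] to
    the unsafe set: each constraint is a half-space, and the distance to the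
    complementary open half-space is the slack divided by the dual norm of [a]
    ([dist_le_norm], [dist_approx]).  Let [d j] be this distance at the sample
    point [zeta j].

    The most harmful distribution in the Wasserstein ball moves shares [t j] of the
    atoms to the unsafe set, at the total cost [N^-1 * \sum_j t j * d j], which the
    radius [delta] bounds.  Hence [x] is in [Zset] iff one cannot move more than
    the share [eps] within this budget, that is, iff the cost [C] of the cheapest
    way to move exactly the share [eps] is at least [delta].  This is a fractional
    knapsack problem, solved by filling up to the [eps]-quantile [s] of [d]
    ([quantile_weights]).  The same [s], with opposite sign, minimises the CVaR
    objective of the empirical distribution, and the minimum is [- C / eps]
    ([cvar_sum_min]); so [C >= delta] is also the CVaR condition, and the infimum is
    attained.

    Both implications about [Zset] are proved with [s] and [t].  If [C < delta], an
    explicit coupling made of Dirac masses gives a distribution in the ball that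
    violates the chance constraint ([transport_ambiguity], [unsafe_transport]).  If
    [C >= delta], integrating
    [s * \1_unsafe xi <= nrm (xi - z) + Num.max (s - f x z) 0] against an arbitrary
    coupling bounds the probability of the unsafe set ([mass_le_transport],
    [safe_mass_ge]).  The integrals make sense because [nrm] is measurable for the
    product sigma-algebra ([measurable_mx_is_norm]), and the dual norm is finite
    because all norms on a finite-dimensional space are equivalent
    ([is_norm_rV_lower]).

    If [a = 0], the safe set is everything or empty, and CVaR is [-oo] or [0]
    accordingly. *)

(** * Fractional knapsack *)

(** The weights are a subgradient at [s] of the convex functions
    [fun r => Num.max (r - d j) 0], chosen with mean [eps]: they form the
    optimal solution of the fractional knapsack that takes the share [eps] of
    the indices at least total cost [\sum_j t j * d j].  The threshold [s] is
    the [eps]-quantile of [d]: indices strictly below it are taken entirely,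
    and the remaining share is spread evenly over those where [d j = s]. *)
Lemma quantile_weights (R : realType) (N : nat) (d : 'I_N -> R) (eps : R) :
  (0 < N)%N -> 0 < eps -> eps < 1 ->
  exists (s : R) (t : 'I_N -> R),
    [/\ forall j, 0 <= t j <= 1,
        \sum_(j < N) t j = N%:R * eps &
        forall j, t j * (s - d j) = Num.max (s - d j) 0].
Proof.
move=> N0 e0 e1.
have N0R : (0 : R) < N%:R by rewrite ltr0n.
pose below r := #|[set j | d j <= r]%SET|%:R : R.
pose P k := N%:R * eps < below (d k).
have [k1 Pk1] : exists k, P k.
  have j0 : 'I_N by exact: Ordinal N0.
  exists [arg max_(k > j0) d k]%O; case: arg_maxP => // k _ kmax.
  rewrite /P /below (_ : [set j | _]%SET = [set: 'I_N]%SET).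
    by rewrite cardsT card_ord gtr_pMr.
  by apply/setP => j; rewrite !inE; exact: kmax.
case: (arg_minP (P := P) d Pk1) => k Pk kmin.
set s := d k.
pose L := #|[set j | d j < s]%SET|%:R : R.
pose M := #|[set j | d j == s]%SET|%:R : R.
have LM : below s = L + M.
  rewrite /below /L /M -natrD -cardsUI [X in (_ + X)%N]eq_card0 ?addn0; last first.
    by move=> j; rewrite !inE; case: ltgtP.
  by congr (_%:R); apply: eq_card => j; rewrite !inE le_eqVlt orbC.
(* Otherwise the largest value below [s] would already satisfy [P]. *)
have Lle : L <= N%:R * eps.
  have [j0 j0s|nos] := pickP (fun j => d j < s); last first.
    rewrite /L eq_card0 ?mulr_ge0 ?ltW// => j; rewrite !inE; exact: nos.
  case: (arg_maxP (P := fun j => d j < s) d j0s) => l ls lmax.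
  rewrite leNgt; apply/negP => Lgt.
  suff /kmin : P l by rewrite leNgt ls.
  apply: (lt_le_trans Lgt); rewrite /L /below ler_nat subset_leq_card//.
  by apply/fintype.subsetP => j; rewrite !inE => /lmax.
have M0 : 0 < M by move: Pk; rewrite /P LM; lra.
pose th := (N%:R * eps - L) / M.
have th01 : 0 <= th <= 1.
  rewrite /th divr_ge0 ?subr_ge0 ?(ltW M0)//= ler_pdivrMr// mul1r.
  by move: Pk; rewrite /P LM; lra.
exists s, (fun j => if d j < s then 1 else if d j == s then th else 0); split.
- by move=> j; case: ifP => _; [lra|case: ifP => _ //; lra].
- rewrite (eq_bigr (fun j => (d j < s)%R%:R + th * (d j == s)%:R)); last first.
    by move=> j _; case: ltgtP => _; rewrite ?mulr0 ?mulr1 ?addr0 ?add0r.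
  rewrite big_split/= -mulr_sumr -!natr_sum.
  have card (A : pred 'I_N) : (\sum_i nat_of_bool (A i) = #|[set j | A j]%SET|)%N.
    by rewrite -sum1dep_card [RHS]big_mkcond.
  rewrite !card -/L -/M /th divfK ?gt_eqF//; lra.
- move=> j; case: (ltgtP (d j) s) => djs.
  + by rewrite mul1r max_l// subr_ge0 ltW.
  + by rewrite mul0r max_r// subr_le0 ltW.
  + by rewrite djs subrr mulr0 maxxx.
Qed.

(** * Norms on spaces of matrices *)

Section norms.
Context (R : realType) (V : lmodType R) (nrm : V -> R).
Hypothesis nrmP : is_norm nrm.

Lemma is_norm0 : nrm 0 = 0.
Proof. by rewrite -(scale0r 0) norm_homogeneous// normr0 mul0r. Qed.

Lemma is_normN u : nrm (- u) = nrm u.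
Proof. by rewrite -scaleN1r norm_homogeneous// normrN normr1 mul1r. Qed.

Lemma is_norm_distC u v : nrm (u - v) = nrm (v - u).
Proof. by rewrite -opprB is_normN. Qed.

Lemma is_norm_ge0 u : 0 <= nrm u.
Proof.
have := norm_triangle nrmP u (- u).
by rewrite subrr is_norm0 is_normN -mulr2n pmulrn_lge0.
Qed.

Lemma is_norm_gt0 u : u != 0 -> 0 < nrm u.
Proof.
move=> u0; rewrite lt_neqAle is_norm_ge0 andbT eq_sym.
by apply: contra_neq u0; exact: norm_definite.
Qed.

Lemma is_norm_sum (J : Type) (r : seq J) (F : J -> V) :
  nrm (\sum_(j <- r) F j) <= \sum_(j <- r) nrm (F j).
Proof.
elim/big_ind2 : _ => [|u a v c ua vc|//]; first by rewrite is_norm0.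
by rewrite (le_trans (norm_triangle nrmP _ _))// lerD.
Qed.

End norms.

Lemma is_norm_mx (R : realType) (m n : nat) (nrm : 'M[R]_(m, n) -> R) u :
  is_norm nrm ->
  nrm u <= \sum_i \sum_j `|u i j| * nrm (delta_mx i j).
Proof.
move=> nrmP; rewrite {1}(matrix_sum_delta u) (le_trans (is_norm_sum nrmP _ _))//.
apply: ler_sum => i _; rewrite (le_trans (is_norm_sum nrmP _ _))//.
by apply: ler_sum => j _; rewrite norm_homogeneous.
Qed.

(** Equivalence of norms in finite dimension: [g] is Lipschitz for the sup norm,
    hence attains a minimum on the sup-norm unit sphere, which is compact; this
    minimum is positive and homogeneity propagates it. *)
Lemma is_norm_rV_lower (R : realType) (k : nat) (g : 'rV[R]_k -> R) :
  is_norm g -> exists2 c, 0 < c & forall v, c * `|v| <= g v.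
Proof.
move=> gP.
pose K := \sum_j g (delta_mx 0 j) + 1.
have K0 : 0 < K.
  by rewrite ltr_wpDl// sumr_ge0// => j _; exact: is_norm_ge0.
have gK v : g v <= K * `|v|.
  rewrite (le_trans (is_norm_mx v gP))// big_ord1 mulrDl mul1r ler_wpDr//.
  rewrite mulr_suml ler_sum// => j _; rewrite mulrC ler_wpM2l//.
    exact: is_norm_ge0.
  rewrite [leRHS]mx_normrE; exact: (le_bigmax _ (fun ij => `|v ij.1 ij.2|) (0, j)).
have gcont : continuous g.
  move=> v; have FF : Filter (nbhs v) by exact: (nbhs_filter (v : 'rV[R]_k)).
  apply/cvgrPdist_lt => e e0; apply/(@nbhs_normP R 'rV[R]_k v).
  exists (e / K); first exact: divr_gt0.
  move=> u /= uv.
  rewrite (@le_lt_trans _ _ (g (v - u)))//.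
    have := norm_triangle gP (v - u) u; have := norm_triangle gP (u - v) v.
    by rewrite !subrK (is_norm_distC gP) ler_norml; lra.
  by rewrite (le_lt_trans (gK _))// mulrC -ltr_pdivlMr.
(* In dimension 0 the unit sphere is empty. *)
have [v0|nov] := pselect (exists v : 'rV[R]_k, v != 0); last first.
  exists 1 => // v; have [->|v0] := eqVneq v 0.
    by rewrite normr0 mulr0 is_norm_ge0.
  by exfalso; apply: nov; exists v.
pose S := [set v : 'rV[R]_k | `|v| = 1].
have unit v : v != 0 -> S (`|v|^-1 *: v).
  move=> vn0; rewrite /S/= normrZ normrV ?unitfE ?normr_eq0// normr_id mulVf//.
  by rewrite normr_eq0.
have S0 : S !=set0 by case: v0 => v /unit; exists (`|v|^-1 *: v).
have Sc : compact S.
  apply: bounded_closed_compact.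
    exists 1; split => // x x1 v /= ->; exact: ltW.
  rewrite (_ : S = (fun v => `|v|) @^-1` [set 1]); last by [].
  apply: closed_comp; last exact: closed_eq.
  by move=> x _; exact: norm_continuous.
have [v /= v1 vmin] := EVT_min_rV S0 Sc (continuous_subspaceT gcont).
have gv0 : 0 < g v.
  apply: is_norm_gt0 => //; apply: contraPneq v1 => ->.
  by rewrite inE/= /S/= normr0 => /esym/eqP; rewrite oner_eq0.
exists (g v) => // u; have [->|u0] := eqVneq u 0.
  by rewrite normr0 mulr0 is_norm_ge0.
have := vmin (`|u|^-1 *: u); rewrite inE => /(_ (unit _ u0)).
rewrite norm_homogeneous// normrV ?unitfE ?normr_eq0// normr_id.
by rewrite mulrC ler_pdivlMr// normr_gt0.
Qed.

(** * Measurability of coordinates and norms *)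

Section measurability.
Context (R : realType).

Lemma measurable_Xi_coord (I n : nat) i j :
  measurable_fun [set: Xi R I n] (fun xi : Xi R I n => (xi : 'M[R]_(I, n + 1)) i j).
Proof.
apply: (measurability _ (RGenInftyO.measurableE R)).
move=> _ [_ [b ->] <-]; rewrite setTI.
apply: sub_sigma_algebra.
apply: (@open_comp 'M[R]_(I, n + 1) R (fun M => M i j)); last exact: interval_open.
by move=> M _; exact: coord_continuous.
Qed.

(** Assuming only that the entries are measurable covers the difference of two
    random matrices, whose sigma-algebra is a product and not generated by open
    sets.  The norm is dominated by a weighted sum [K] of absolute values of
    entries, so [nrm v < t] holds iff some rational matrix [q] has
    [K (v - q) < t - nrm q]; the strict sublevel sets are thus countable unions of
    sets defined by finite sums of entries. *)
Lemma measurable_mx_is_norm d (T : measurableType d) (m n : nat)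
    (nrm : 'M[R]_(m, n) -> R) (u : T -> 'M[R]_(m, n)) :
  is_norm nrm -> (forall i j, measurable_fun setT (fun w => u w i j)) ->
  measurable_fun setT (nrm \o u).
Proof.
move=> nrmP mu.
pose K (v : 'M[R]_(m, n)) := \sum_i \sum_j `|v i j| * nrm (delta_mx i j).
pose emb (q : 'M[rat]_(m, n)) : 'M[R]_(m, n) := map_mx ratr q.
have mK q : measurable_fun setT (fun w => K (u w - emb q)).
  apply: measurable_sum => i; apply: measurable_sum => j.
  apply: measurable_funM => //; apply: measurableT_comp => //.
  rewrite (_ : (fun _ => _) = (fun w => u w i j - emb q i j)).
    exact: measurable_funB.
  by apply/funext => w; rewrite !mxE.
apply: (measurability _ (RGenInftyO.measurableE R)).
move=> _ [_ [t ->] <-]; rewrite setTI.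
rewrite (_ : _ @^-1` _ =
    \bigcup_(q in [set: 'M[rat]_(m, n)])
      [set w | K (u w - emb q) < t - nrm (emb q)]).
  apply: countable_bigcupT_measurable; first exact: countableP.
  move=> q; have := mK q measurableT _ (measurable_itv `]-oo, t - nrm (emb q)[).
  by rewrite setTI.
apply/seteqP; split => w /=; rewrite in_itv/=.
  move=> ut.
  pose S := \sum_i \sum_j nrm (delta_mx i j : 'M[R]_(m, n)).
  have S0 : 0 <= S.
    by apply: sumr_ge0 => i _; apply: sumr_ge0 => j _; exact: is_norm_ge0.
  (* A rational matrix within [e] of [u w] entrywise is within [e * S] both for
     [K] and for [nrm], and these two errors must stay below [t - nrm (u w)]. *)
  pose e := (t - nrm (u w)) / (2 * (S + 1)).
  have e0 : 0 < e by rewrite divr_gt0 ?subr_gt0// mulr_gt0//; lra.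
  have /choice[q qP] (ij : 'I_m * 'I_n) :
      exists q : rat, `|u w ij.1 ij.2 - ratr q| <= e.
    have /rat_in_itvoo[q] : u w ij.1 ij.2 - e < u w ij.1 ij.2 + e by lra.
    rewrite in_itv/= => qe; exists q; rewrite ler_norml; lra.
  exists (\matrix_(i, j) q (i, j)) => //=; set Q := emb _.
  have KS : K (u w - Q) <= e * S.
    rewrite mulr_sumr ler_sum// => i _; rewrite mulr_sumr ler_sum// => j _.
    by rewrite !mxE ler_wpM2r ?is_norm_ge0//; exact: (qP (i, j)).
  have eS : 2 * (e * S) < t - nrm (u w).
    have -> : t - nrm (u w) = 2 * (e * S) + 2 * e by rewrite /e; field; lra.
    by rewrite ltrDl mulr_gt0.
  have := norm_triangle nrmP (Q - u w) (u w); rewrite subrK.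
  by have := is_norm_mx (u w - Q) nrmP; rewrite -/(K _) (is_norm_distC nrmP); lra.
move=> [q _ /=] Kq.
have := norm_triangle nrmP (u w - emb q) (emb q); rewrite subrK.
have := is_norm_mx (u w - emb q) nrmP; rewrite -/(K _); lra.
Qed.

End measurability.

(** * The dual norm *)

Section dual_norm.
Context (R : realType) (I n : nat) (nrm : 'M[R]_(I, n + 1) -> R).
Hypothesis nrmP : is_norm nrm.
Implicit Types (a : 'cV[R]_(n + 1)) (u v : 'M[R]_(I, n + 1)) (i : 'I_I).

Lemma dot_blockE a u i : dot a (block u i) = \sum_j a j 0 * u i j.
Proof. by apply: eq_bigr => j _; rewrite !mxE. Qed.

Lemma dot_blockD a u v i :
  dot a (block (u + v) i) = dot a (block u i) + dot a (block v i).
Proof. by rewrite !dot_blockE -big_split; apply: eq_bigr => j _; rewrite !mxE mulrDr. Qed.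

Lemma dot_blockZ a c u i : dot a (block (c *: u) i) = c * dot a (block u i).
Proof. by rewrite !dot_blockE mulr_sumr; apply: eq_bigr => j _; rewrite !mxE mulrCA. Qed.

Lemma dot0_block i u : dot 0 (block u i) = 0.
Proof. by rewrite dot_blockE big1// => j _; rewrite mxE mul0r. Qed.

(** This is what makes the supremum defining the dual norm finite. *)
Lemma coord_le_norm : exists2 c, 0 < c & forall u i j, c * `|u i j| <= nrm u.
Proof.
have [|c c0 cP] := @is_norm_rV_lower R _ (nrm \o vec_mx).
  split => [u v|c u|u] /=.
  - by rewrite linearD norm_triangle.
  - by rewrite linearZ norm_homogeneous.
  - by move/(norm_definite nrmP)/(congr1 mxvec); rewrite vec_mxK linear0.
exists c => // u i j; have := cP (mxvec u); rewrite /= mxvecK; apply: le_trans.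
rewrite ler_pM2l// -mxvecE [leRHS]mx_normrE.
exact: (le_bigmax _ (fun ij => `|mxvec u ij.1 ij.2|) (0, _)).
Qed.

Lemma dual_norm_has_sup a i :
  has_sup [set dot a (block u i) | u in [set u | nrm u <= 1]].
Proof.
split.
  by exists (dot a (block 0 i)), 0 => //=; rewrite is_norm0.
have [c c0 cP] := coord_le_norm.
exists (\sum_j `|a j 0| * c^-1) => _ /= [u u1 <-].
rewrite dot_blockE ler_sum// => j _.
rewrite (le_trans (ler_norm _))// normrM ler_wpM2l//.
by rewrite -[c^-1]mul1r ler_pdivlMr// mulrC (le_trans (cP _ _ _)).
Qed.

Lemma dot_le_dual_norm a u i : dot a (block u i) <= dual_norm nrm i a * nrm u.
Proof.
have [->|u0] := eqVneq u 0.
  by rewrite is_norm0// mulr0 -(scale0r 0) dot_blockZ mul0r.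
have nu0 := is_norm_gt0 nrmP u0.
rewrite -ler_pdivrMr// mulrC -dot_blockZ.
apply: sup_ubound; first by case: (dual_norm_has_sup a i).
exists ((nrm u)^-1 *: u) => //=.
by rewrite norm_homogeneous// gtr0_norm ?invr_gt0// mulVf// gt_eqF.
Qed.

Lemma dual_norm_gt0 a i : a != 0 -> 0 < dual_norm nrm i a.
Proof.
move=> a0; pose u : 'M[R]_(I, n + 1) := \matrix_(k, j) a j 0.
have au : dot a (block u i) = \sum_j a j 0 ^+ 2.
  by rewrite dot_blockE; apply: eq_bigr => j _; rewrite mxE expr2.
have {}au : 0 < dot a (block u i).
  rewrite au lt_neqAle sumr_ge0 ?andbT; last by move=> j _; exact: sqr_ge0.
  apply: contra_neqN a0 => /eqP/esym sum0.
  apply/matrixP => j k; rewrite ord1 mxE.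
  have /psumr_eq0P := sum0.
  move=> /(_ (fun j _ => sqr_ge0 (a j 0)) j isT)/eqP.
  by rewrite sqrf_eq0 => /eqP.
have := lt_le_trans au (dot_le_dual_norm a u i).
by have := is_norm_ge0 nrmP u; nra.
Qed.

Lemma dual_norm_adherent a i r : r < dual_norm nrm i a ->
  exists2 u, nrm u <= 1 & r < dot a (block u i).
Proof.
move=> ra; have e0 : 0 < dual_norm nrm i a - r by rewrite subr_gt0.
have [_ [u u1 <-] ru] := sup_adherent e0 (dual_norm_has_sup a i).
by exists u => //; move: ru; rewrite /dual_norm; lra.
Qed.

End dual_norm.

(** * The function f as distance to the unsafe set *)

Section distance_to_unsafe.
Context (R : realType) (I n : nat) (nrm : 'M[R]_(I, n + 1) -> R).
Variables (eta1 eta2 : bool) (B : 'I_I -> 'cV[R]_n) (b : 'I_I -> R).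
Hypotheses (nrmP : is_norm nrm) (I_gt0 : (0 < I)%N).
Variable x : 'cV[R]_n.
Local Notation a := (avec eta1 eta2 x).
Local Notation dist := (f nrm eta1 eta2 B b x).
Hypothesis a_neq0 : a != 0.

Let gap (z : Xi R I n) i : \bar R :=
  (Num.max (bfun B b i x - dot a (block z i)) 0 / dual_norm nrm i a)%:E.

Let distE z : dist z = \big[mine/+oo%E]_i gap z i.
Proof.
rewrite /f /calI (negPf a_neq0) [X in mine _ X]big_pred0; last first.
  by move=> i; rewrite inE.
by rewrite miney; apply: eq_bigl => i; rewrite inE.
Qed.

Lemma dist_attained z : exists i, dist z = gap z i.
Proof.
rewrite distE.
have le_y i : true -> (gap z i <= +oo)%E by move=> _; exact: leey.
by have [i _ ->] := eq_bigmin (Ordinal I_gt0) xpredT (gap z) isT le_y; exists i.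
Qed.

Lemma gap_ge0 z i : (0 <= gap z i)%E.
Proof.
rewrite lee_fin divr_ge0 ?(ltW (dual_norm_gt0 _ _ _))//.
by rewrite le_max lexx orbT.
Qed.

Lemma dist_ge0 z : (0 <= dist z)%E.
Proof. by have [i ->] := dist_attained z; exact: gap_ge0. Qed.

Lemma dist_fin_num z : dist z \is a fin_num.
Proof. by have [i ->] := dist_attained z. Qed.

(** Leaving the safe set through constraint [i] requires increasing
    [dot a (block _ i)] by more than the slack, and by duality a displacement of
    norm [r] increases it by at most [dual_norm nrm i a * r]. *)
Lemma dist_le_norm z xi : ~ safe eta1 eta2 B b x xi ->
  (dist z <= (nrm ((xi : 'M[R]_(I, n + 1)) - (z : 'M[R]_(I, n + 1))))%:E)%E.
Proof.
move=> /existsNP[i /negP]; rewrite -ltNge => bi.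
rewrite distE (@le_trans _ _ (gap z i))//; first exact: bigmin_le_cond.
have D0 := dual_norm_gt0 nrmP i a_neq0.
rewrite lee_fin ler_pdivrMr// ge_max mulr_ge0 ?(is_norm_ge0 nrmP) ?(ltW D0)// andbT.
have := dot_le_dual_norm nrmP a ((xi : 'M[R]_(I, n + 1)) - (z : 'M[R]_(I, n + 1))) i.
by rewrite -scaleN1r dot_blockD dot_blockZ; lra.
Qed.

(** The unsafe set is open, so the distance is only approached: the margin [k]
    leaves room both for the strict inequality and for an almost maximising
    direction in the definition of the dual norm. *)
Lemma dist_approx z k : 0 < k -> exists2 xi, ~ safe eta1 eta2 B b x xi &
  ((nrm ((xi : 'M[R]_(I, n + 1)) - (z : 'M[R]_(I, n + 1))))%:E <= dist z + k%:E)%E.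
Proof.
move=> k0; have [i di] := dist_attained z.
have d0 := dist_ge0 z.
rewrite di /gap in d0 *.
set D := dual_norm nrm i a in d0 *; set m := Num.max _ _ in d0 *.
have D0 : 0 < D by exact: dual_norm_gt0.
have m0 : 0 <= m by rewrite /m le_max lexx orbT.
have r0 : 0 < m / D + k by rewrite ltr_wpDl// divr_ge0// ltW.
have rD : m / (m / D + k) < D.
  by rewrite ltr_pdivrMr// mulrDr mulrC divfK ?gt_eqF// ltrDl mulr_gt0.
have [u u1 mu] := dual_norm_adherent nrmP rD.
exists ((z : 'M[R]_(I, n + 1)) + (m / D + k) *: u).
  move=> /(_ i); rewrite dot_blockD dot_blockZ.
  rewrite ltr_pdivrMr// mulrC in mu.
  have : bfun B b i x - dot a (block z i) <= m by rewrite /m le_max lexx.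
  lra.
rewrite addrAC subrr add0r norm_homogeneous// (gtr0_norm r0) -EFinD lee_fin.
by rewrite ler_piMr// ltW.
Qed.

End distance_to_unsafe.

Section measurability_of_constraint.
Context (R : realType) (I n : nat) (nrm : 'M[R]_(I, n + 1) -> R).
Variables (eta1 eta2 : bool) (B : 'I_I -> 'cV[R]_n) (b : 'I_I -> R).
Variable x : 'cV[R]_n.

Lemma measurable_dot_block (a : 'cV[R]_(n + 1)) i :
  measurable_fun [set: Xi R I n] (fun z : Xi R I n => dot a (block z i)).
Proof.
under eq_fun do rewrite dot_blockE.
apply: measurable_sum => j; apply: measurable_funM => //.
exact: measurable_Xi_coord.
Qed.

Lemma measurable_safe : measurable (safe eta1 eta2 B b x).
Proof.
rewrite (_ : safe _ _ _ _ _ = \bigcap_i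
    [set xi : Xi R I n | dot (avec eta1 eta2 x) (block xi i) <= bfun B b i x]).
  apply: fin_bigcap_measurable => // i _.
  have := measurable_dot_block (avec eta1 eta2 x) i measurableT
    (measurable_itv `]-oo, bfun B b i x]).
  by rewrite setTI.
by apply/seteqP; split => [xi h i _|xi h i]; [exact: h|exact: (h i Logic.I)].
Qed.

Lemma measurable_f : measurable_fun setT (f nrm eta1 eta2 B b x).
Proof.
have big (P : pred 'I_I) (F : 'I_I -> Xi R I n -> \bar R) :
    (forall i, measurable_fun setT (F i)) ->
    measurable_fun setT (fun z => \big[mine/+oo%E]_(i | P i) F i z).
  move=> mF; under eq_fun do rewrite big_mkcond.
  elim: (index_enum _) => [|i s IH].
    by under eq_fun do rewrite big_nil; exact: measurable_cst.
  under eq_fun do rewrite big_cons.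
  by apply: measurable_mine => //; case: (P i).
apply: measurable_mine; apply: big => // i.
apply/measurable_EFinP; apply: measurable_funM => //.
apply: measurable_maxr => //; apply: measurable_funB => //.
exact: measurable_dot_block.
Qed.

End measurability_of_constraint.

(** * Finite mixtures of Dirac measures *)

Section mixture.
Context d (T : measurableType d) (R : realType) (J : finType).
Variables (w : J -> {nonneg R}) (p : J -> T).

(** [msum] sums over an initial segment of [nat], so [J] is enumerated; the
    null measure fills the indices past the end. *)
Let piece (k : nat) : {measure set T -> \bar R} :=
  if insub k is Some i
  then mscale (w (enum_val (i : 'I_#|J|))) \d_(p (enum_val i)) else mzero.

Definition mixture : set T -> \bar R := msum piece #|J|.

HB.instance Definition _ := Measure.on mixture.

Lemma mixtureE A : mixture A = (\sum_j (w j)%:num%:E * \d_(p j) A)%E.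
Proof.
rewrite /mixture /msum [RHS](reindex _ (onW_bij _ (@enum_val_bij J))).
by apply: eq_bigr => i _; rewrite /piece valK.
Qed.

Lemma integral_mixture (g : T -> \bar R) :
  measurable_fun setT g -> (forall x, 0 <= g x)%E ->
  (\int[mixture]_x g x = \sum_j (w j)%:num%:E * g (p j))%E.
Proof.
move=> mg g0; rewrite ge0_integral_measure_sum//.
rewrite [RHS](reindex _ (onW_bij _ (@enum_val_bij J))).
apply: eq_bigr => i _; rewrite /piece valK ge0_integral_mscale//.
by rewrite integral_dirac// diracT mul1e.
Qed.

End mixture.

Section probability_mixture.
Context d (T : measurableType d) (R : realType) (J : finType).
Variables (w : J -> {nonneg R}) (p : J -> T).
Hypothesis w1 : \sum_j (w j)%:num = 1.

(** The proof argument lets the probability structure be inferred from the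
    term. *)
Definition pmixture of \sum_j (w j)%:num = 1 : set T -> \bar R := mixture w p.
Local Notation mu := (pmixture w1).

HB.instance Definition _ := Measure.on mu.

Let mixture_setT : mu setT = 1%E.
Proof.
rewrite /pmixture mixtureE -w1 -sumEFin.
by apply: eq_bigr => j _; rewrite diracT mule1.
Qed.

HB.instance Definition _ := Measure_isProbability.Build _ _ _ mu mixture_setT.

End probability_mixture.

Lemma integral_empirical d (T : measurableType d) (R : realType) (N : nat)
    (N_gt0 : (0 < N)%N) (zeta : 'I_N -> T) (g : T -> \bar R) :
  measurable_fun setT g -> (forall x, 0 <= g x)%E ->
  (\int[empirical R zeta N_gt0]_x g x = N%:R^-1%:E * \sum_j g (zeta j))%E.
Proof.
move=> mg g0.
have N0 : 0 <= N%:R^-1 :> R by rewrite invr_ge0.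
rewrite (eq_measure_integral (mixture (fun=> NngNum N0) zeta)).
  by rewrite integral_mixture// ge0_sume_distrr.
by move=> A _ _; rewrite /= /empirical [RHS]mixtureE ge0_sume_distrr.
Qed.

(** * Transport plans and the ambiguity set *)

Section transport.
Context (R : realType) (I n N : nat) (nrm : 'M[R]_(I, n + 1) -> R).
Variables (N_gt0 : (0 < N)%N) (zeta : 'I_N -> Xi R I n).
Local Notation P0 := (empirical R zeta N_gt0).
Hypothesis nrm_measurable : measurable_fun setT (fun q : Xi R I n * Xi R I n =>
  nrm ((q.1 : 'M[R]_(I, n + 1)) - (q.2 : 'M[R]_(I, n + 1)))).
Hypotheses (nrm_ge0 : forall u, 0 <= nrm u) (nrm0 : nrm 0 = 0).
Local Notation ndist u v := (nrm ((u : 'M[R]_(I, n + 1)) - (v : 'M[R]_(I, n + 1)))).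

(** The share [t j] of the atom at [zeta j] is moved to [xi j] and the rest stays.
    The coupling is indexed by [(j, moved)]. *)
Lemma transport_ambiguity (delta : R) (t : 'I_N -> R) (xi : 'I_N -> Xi R I n) :
  (forall j, 0 <= t j <= 1) ->
  N%:R^-1 * \sum_j t j * ndist (xi j) (zeta j) <= delta ->
  exists2 P, ambiguity nrm P0 delta P &
    forall A, P A = (\sum_j
      (((1 - t j) / N%:R)%:E * \d_(zeta j) A + (t j / N%:R)%:E * \d_(xi j) A))%E.
Proof.
move=> t01 cost.
have N0 : 0 < N%:R :> R by rewrite ltr0n.
pose w0 (k : 'I_N * bool) : R := (if k.2 then t k.1 else 1 - t k.1) / N%:R.
have w0_ge0 k : 0 <= w0 k.
  by rewrite divr_ge0// ?ler0n//; have := t01 k.1; case: k.2; lra.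
pose w k : {nonneg R} := NngNum (w0_ge0 k).
have sumE (V : nmodType) (F : 'I_N * bool -> V) :
    \sum_k F k = \sum_j (F (j, false) + F (j, true)).
  rewrite (eq_bigr (fun k => F (k.1, k.2))); last by case.
  rewrite -(pair_bigA _ (fun j c => F (j, c)))/=.
  by apply: eq_bigr => j _; rewrite big_bool addrC.
have w1 : \sum_k (w k)%:num = 1.
  rewrite sumE (eq_bigr (fun=> N%:R^-1)) => [|j _]; last first.
    by rewrite /= /w0/= -mulrDl subrK mul1r.
  by rewrite sumr_const card_ord -[_ *+ N]mulr_natl divff// gt_eqF.
pose src (k : 'I_N * bool) : Xi R I n := if k.2 then xi k.1 else zeta k.1.
pose pr (k : 'I_N * bool) : Xi R I n * Xi R I n := (src k, zeta k.1).
exists (pmixture src w1); last first.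
  by move=> A; rewrite [LHS]mixtureE sumE.
apply: (@le_trans _ _ (\int[pmixture pr w1]_q (ndist q.1 q.2)%:E)%E).
  apply: ereal_inf_lbound; exists (pmixture pr w1) => // A mA; split.
    by rewrite [LHS]mixtureE [RHS]mixtureE.
  rewrite [LHS]mixtureE sumE /= /empirical ge0_sume_distrr; last first.
    by move=> j _; exact: measure_ge0.
  apply: eq_bigr => j _; rewrite -ge0_muleDl ?lee_fin ?w0_ge0//.
  by rewrite /= /w0/= -EFinD -mulrDl subrK mul1r.
rewrite [leLHS]integral_mixture; last 2 first.
- exact/measurable_EFinP.
- by move=> q; rewrite lee_fin.
rewrite sumE.
rewrite (eq_bigr (fun j => (N%:R^-1 * (t j * ndist (xi j) (zeta j)))%:E)).
  by rewrite sumEFin -mulr_sumr lee_fin.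
move=> j _; rewrite /= subrr nrm0 mule0 add0e -EFinM /w0/=.
by rewrite mulrAC mulrC.
Qed.

(** Weak duality for the Wasserstein ball: integrating the pointwise inequality
    [s * \1_A xi <= ndist xi z + h z] against a coupling bounds the mass of [A]
    by the transport cost plus the mean of [h] over the sample. *)
Lemma mass_le_transport (P : probability (Xi R I n) R) (A : set (Xi R I n))
    (h : Xi R I n -> R) (s delta : R) :
  ambiguity nrm P0 delta P -> measurable A -> 0 <= s ->
  measurable_fun setT h -> (forall z, 0 <= h z) ->
  (forall xi z, A xi -> s <= ndist xi z + h z) ->
  (s%:E * P A <= (delta + N%:R^-1 * \sum_j h (zeta j))%:E)%E.
Proof.
move=> WP mA s0 mh h0 sh.
rewrite EFinD -leeBlDr//; apply: le_trans WP.
apply: le_ereal_inf_tmp => _ [Q QP <-].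
rewrite leeBlDr//.
have mfA : measurable (fst @^-1` A : set (Xi R I n * Xi R I n)).
  by rewrite -[_ @^-1` _]setTI; exact: measurable_fst.
have -> : (P A = \int[Q]_q (\1_(fst @^-1` A) q)%:E)%E.
  by rewrite integral_indic// setIT; case: (QP A mA).
have -> : ((N%:R^-1 * \sum_j h (zeta j))%:E = \int[Q]_q (h q.2)%:E)%E.
  have -> : (\int[Q]_q (h q.2)%:E = \int[pushforward Q snd]_z (h z)%:E)%E.
    rewrite ge0_integral_pushforward//; first exact/measurable_EFinP.
    by move=> z _; rewrite lee_fin.
  rewrite (eq_measure_integral P0); last by move=> B mB _; case: (QP B mB).
  rewrite integral_empirical; first by rewrite sumEFin -EFinM.
  - exact/measurable_EFinP.
  - by move=> z; rewrite lee_fin.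
rewrite -ge0_integralD//; last 4 first.
- by move=> q _; rewrite lee_fin.
- exact/measurable_EFinP.
- by move=> q _; rewrite lee_fin.
- by apply/measurable_EFinP; exact: (measurableT_comp mh measurable_snd).
rewrite -ge0_integralZl//; last first.
- by apply/measurable_EFinP; exact: measurable_indic.
apply: ge0_le_integral => //.
- by move=> q _; rewrite -EFinM lee_fin mulr_ge0.
- apply/measurable_EFinP; apply: measurable_funM => //; exact: measurable_indic.
- apply/measurable_EFinP; apply: measurable_funD => //.
  exact: (measurableT_comp mh measurable_snd).
- move=> q _; rewrite -EFinM -EFinD lee_fin indicE.
  have [qA|_] := boolP (q \in _); last by rewrite mulr0 addr_ge0.
  by rewrite mulr1; apply: sh; rewrite inE in qA.
Qed.

End transport.

(** * CVaR of an empirical distribution *)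

Section empirical_cvar.
Context (R : realType) (N : nat) (N_gt0 : (0 < N)%N).
Variables (eps : R) (eps_gt0 : 0 < eps).

(** The objective of CVaR for the losses [- d j], each of probability [1 / N]. *)
Definition cvar_sum (d : 'I_N -> R) (gamma : R) : R :=
  gamma + eps^-1 * (N%:R^-1 * \sum_j Num.max (- d j - gamma) 0).

Lemma cvar_objective_empirical disp (T : measurableType disp) (zeta : 'I_N -> T)
    (F : T -> \bar R) gamma :
  measurable_fun setT F -> (forall z, F z \is a fin_num) ->
  cvar_objective (empirical R zeta N_gt0) eps (fun z => - F z)%E gamma =
  (cvar_sum (fun j => fine (F (zeta j))) gamma)%:E.
Proof.
move=> mF Ffin; rewrite /cvar_objective integral_empirical; last 2 first.
- apply: measurable_maxe => //; apply: emeasurable_funB => //.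
  apply: (measurableT_comp _ mF); exact: oppe_measurable.
- by move=> z; rewrite le_max lexx orbT.
rewrite /cvar_sum (eq_bigr (fun j => (Num.max (- fine (F (zeta j)) - gamma) 0)%:E)).
  by rewrite sumEFin -!EFinM -EFinD.
by move=> j _; rewrite -[F _]fineK// -EFin_max.
Qed.

Lemma mean_weighted_gap (d t : 'I_N -> R) (r : R) :
  \sum_j t j = N%:R * eps ->
  N%:R^-1 * \sum_j t j * (r - d j) = eps * r - N%:R^-1 * \sum_j t j * d j.
Proof.
move=> tsum; under eq_bigr do rewrite mulrBr.
rewrite big_split/= sumrN -mulr_suml tsum mulrBr !mulrA mulVf ?mul1r//.
by rewrite gt_eqF// ltr0n.
Qed.

(** Since [t j * (r - d j) <= Num.max (r - d j) 0] for every [r], with equality at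
    [r = s], and since the weights have mean [eps], the terms in [r] cancel in the
    lower bound so obtained: [- s] is a minimiser and the minimum is, up to the
    factor [eps], minus the cost of the knapsack. *)
Lemma cvar_sum_min (d : 'I_N -> R) (s : R) (t : 'I_N -> R) :
  (forall j, 0 <= t j <= 1) -> \sum_j t j = N%:R * eps ->
  (forall j, t j * (s - d j) = Num.max (s - d j) 0) ->
  (forall gamma, cvar_sum d (- s) <= cvar_sum d gamma) /\
  eps * cvar_sum d (- s) = - (N%:R^-1 * \sum_j t j * d j).
Proof.
move=> t01 tsum tmax.
have N0 : 0 < N%:R :> R by rewrite ltr0n.
have val r := mean_weighted_gap d r tsum.
have at_s : eps * cvar_sum d (- s) = - (N%:R^-1 * \sum_j t j * d j).
  rewrite /cvar_sum mulrDr mulrA divff ?gt_eqF// mul1r.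
  under eq_bigr do rewrite opprK addrC -tmax.
  by rewrite val; lra.
split => // gamma; rewrite -(ler_pM2l eps_gt0) at_s.
rewrite /cvar_sum mulrDr mulrA divff ?gt_eqF// mul1r.
have : N%:R^-1 * \sum_j t j * (- gamma - d j) <=
    N%:R^-1 * \sum_j Num.max (- d j - gamma) 0.
  rewrite ler_wpM2l ?invr_ge0 ?(ltW N0)// ler_sum// => j _.
  rewrite addrC; have /andP[t0 t1] := t01 j.
  have [g0|g0] := leP (- d j - gamma) 0; first by nra.
  by nra.
by rewrite val; lra.
Qed.

End empirical_cvar.

(** * Chance constraint and CVaR at a given decision *)

Section chance_constraint_at.
Context (R : realType) (n I N : nat).
Hypotheses (I_gt0 : (0 < I)%N) (N_gt0 : (0 < N)%N).
Variables (eps delta : R).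
Hypotheses (eps_gt0 : 0 < eps) (eps_lt1 : eps < 1) (delta_gt0 : 0 < delta).
Variables (eta1 eta2 : bool) (B : 'I_I -> 'cV[R]_n) (b : 'I_I -> R).
Variable nrm : 'M[R]_(I, n + 1) -> R.
Hypothesis nrmP : is_norm nrm.
Variable zeta : 'I_N -> Xi R I n.
Variable x : 'cV[R]_n.

Local Notation P0 := (empirical R zeta N_gt0).
Local Notation dist := (f nrm eta1 eta2 B b x).
Local Notation S := (safe eta1 eta2 B b x).
Local Notation X := (fun z : Xi R I n => - dist z)%E.
Local Notation ndist u v := (nrm ((u : 'M[R]_(I, n + 1)) - (v : 'M[R]_(I, n + 1)))).

Let N0 : 0 < N%:R :> R. Proof. by rewrite ltr0n. Qed.

Let measurable_ndist : measurable_fun setT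
  (fun q : Xi R I n * Xi R I n => ndist q.1 q.2).
Proof.
apply: (measurable_mx_is_norm nrmP) => i j.
rewrite (_ : (fun _ => _) = (fun q : Xi R I n * Xi R I n =>
    (q.1 : 'M[R]_(I, n + 1)) i j - (q.2 : 'M[R]_(I, n + 1)) i j)).
  apply: measurable_funB.
  - exact: (measurableT_comp (measurable_Xi_coord i j) measurable_fst).
  - exact: (measurableT_comp (measurable_Xi_coord i j) measurable_snd).
by apply/funext => q; rewrite !mxE.
Qed.

Lemma ambiguity_neq0 : ambiguity nrm P0 delta !=set0.
Proof.
have [||P PW _] := @transport_ambiguity R I n N nrm N_gt0 zeta measurable_ndist
    (is_norm_ge0 nrmP) (is_norm0 nrmP) delta (fun=> 0) zeta.
- by move=> j; rewrite lexx ler01.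
- by rewrite big1 ?mulr0 ?ltW// => j _; rewrite mul0r.
by exists P.
Qed.

Section proper_constraint.
Hypothesis a_neq0 : avec eta1 eta2 x != 0.

Let d j : R := fine (dist (zeta j)).

Let dE j : dist (zeta j) = (d j)%:E.
Proof. by rewrite fineK// dist_fin_num. Qed.

Let d_ge0 j : 0 <= d j.
Proof. by rewrite -lee_fin -dE dist_ge0. Qed.

Let objE gamma : cvar_objective P0 eps X gamma = (cvar_sum eps d gamma)%:E.
Proof.
rewrite cvar_objective_empirical//; first exact: measurable_f.
by move=> z; exact: dist_fin_num.
Qed.

(** A knapsack of cost below [delta] makes the unsafe set more than
    [eps]-probable.  The strict inequality is spent twice: the weights are pushed
    towards [1] by a factor [l] so that their mean exceeds [eps], and the atoms are
    moved slightly further than the distance so as to reach the unsafe set. *)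
Lemma unsafe_transport (t : 'I_N -> R) :
  (forall j, 0 <= t j <= 1) -> \sum_j t j = N%:R * eps ->
  N%:R^-1 * \sum_j t j * d j < delta ->
  exists2 P, ambiguity nrm P0 delta P & (P S < (1 - eps)%:E)%E.
Proof.
move=> t01 tsum; set C := _ * _ => Cdelta.
pose D := N%:R^-1 * \sum_j d j.
have D0 : 0 <= D by rewrite mulr_ge0 ?invr_ge0 ?(ltW N0)// sumr_ge0.
(* [k] is the excess length of each move, and [l] is such that [l * D <= k]. *)
pose k := (delta - C) / 2.
have k0 : 0 < k by rewrite /k; lra.
pose l := k / (D + k).
have Dk0 : 0 < D + k by lra.
have l0 : 0 < l by rewrite divr_gt0.
have l1 : l <= 1 by rewrite ler_pdivrMr//; lra.
have lD : l * D <= k.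
  by rewrite /l mulrAC ler_pdivrMr// ler_pM2l//; lra.
have C0 : 0 <= C.
  rewrite mulr_ge0 ?invr_ge0 ?(ltW N0)// sumr_ge0// => j _.
  by rewrite mulr_ge0//; case/andP: (t01 j).
pose t' j := (1 - l) * t j + l.
have t'01 j : 0 <= t' j <= 1.
  by have := t01 j; rewrite /t'; nra.
have /choice[xi xiP] j : exists xi, ~ S xi /\ ndist xi (zeta j) <= d j + k.
  have [xi Sxi] := dist_approx B b nrmP I_gt0 a_neq0 (zeta j) k0.
  by rewrite dE -EFinD lee_fin => ?; exists xi.
have mean_t' : N%:R^-1 * \sum_j t' j = (1 - l) * eps + l.
  rewrite big_split/= -mulr_sumr tsum sumr_const card_ord -[l *+ N]mulr_natl.
  by field; rewrite gt_eqF.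
have mean1 : N%:R^-1 * \sum_(j < N) 1 = 1 :> R.
  by rewrite sumr_const card_ord mulVf// gt_eqF.
have cost : N%:R^-1 * \sum_j t' j * ndist (xi j) (zeta j) <= delta.
  apply: (@le_trans _ _ (N%:R^-1 *
      \sum_j (((1 - l) * (t j * d j) + l * d j) + k * t' j))).
    rewrite ler_pM2l ?invr_gt0// ler_sum// => j _.
    have [_ xid] := xiP j; have /andP[t'0 _] := t'01 j.
    by rewrite (le_trans (ler_wpM2l t'0 xid))// /t'; lra.
  rewrite !big_split/= -!mulr_sumr !mulrDr !(mulrCA N%:R^-1) -/C -/D mean_t'.
  have -> : delta = C + 2 * k by rewrite /k; lra.
  have el : 0 <= (1 - l) * (1 - eps) by rewrite mulr_ge0 ?subr_ge0// ltW.
  have kM : k * ((1 - l) * eps + l) <= k by rewrite ler_piMr ?(ltW k0)//; lra.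
  have lC : 0 <= l * C by rewrite mulr_ge0 ?(ltW l0).
  by lra.
have [P PW PE] := transport_ambiguity N_gt0 measurable_ndist (is_norm_ge0 nrmP)
  (is_norm0 nrmP) t'01 cost.
exists P => //; rewrite PE.
apply: (@le_lt_trans _ _ (\sum_j ((1 - t' j) / N%:R)%:E)%E).
  apply: lee_sum => j _; have [nS _] := xiP j.
  rewrite [X in (_ + _ * X)%E]diracE memNset// mule0 adde0.
  rewrite diracE -EFinM lee_fin ler_piMr//; last by case: (_ \in _).
  by rewrite divr_ge0 ?ler0n//; have := t'01 j; lra.
rewrite sumEFin lte_fin -mulr_suml mulrC sumrB mulrBr mean1 mean_t'.
have : 0 < l * (1 - eps) by rewrite mulr_gt0 ?subr_gt0.
by lra.
Qed.

(** Weak duality with the multiplier [s] of the knapsack: an unsafe [xi] is at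
    distance at least [fine (dist z)] from [z], so that
    [s <= ndist xi z + Num.max (s - fine (dist z)) 0].  The mean of the last
    term over the sample is [eps * s] minus the cost of the knapsack. *)
Lemma safe_mass_ge (s : R) (t : 'I_N -> R) (P : probability (Xi R I n) R) :
  (forall j, 0 <= t j <= 1) -> \sum_j t j = N%:R * eps ->
  (forall j, t j * (s - d j) = Num.max (s - d j) 0) ->
  delta <= N%:R^-1 * \sum_j t j * d j ->
  ambiguity nrm P0 delta P -> ((1 - eps)%:E <= P S)%E.
Proof.
move=> t01 tsum tmax deltaC PW.
have mS := measurable_safe eta1 eta2 B b x.
pose h (z : Xi R I n) : R := Num.max (s - fine (dist z)) 0.
have mh : measurable_fun setT h.
  apply: measurable_maxr => //; apply: measurable_funB => //.
  by apply: measurableT_comp => //; exact: measurable_f.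
have h0 z : 0 <= h z by rewrite /h le_max lexx orbT.
pose M : R := N%:R^-1 * \sum_j h (zeta j).
have M0 : 0 <= M by rewrite mulr_ge0 ?invr_ge0 ?(ltW N0)// sumr_ge0.
have ME : M = eps * s - N%:R^-1 * \sum_j t j * d j.
  have hE j : h (zeta j) = t j * (s - d j) by rewrite tmax.
  by rewrite /M -mean_weighted_gap//; under eq_bigr do rewrite hE.
have s0 : 0 < s.
  rewrite -(pmulr_rgt0 s eps_gt0).
  have -> : eps * s = M + N%:R^-1 * \sum_j t j * d j by rewrite ME subrK.
  by rewrite ltr_wpDl// (lt_le_trans delta_gt0).
have PU : P (~` S) = (1 - fine (P S))%:E.
  by rewrite probability_setC// -[P S in LHS]fineK// fin_num_measure.
have sh xi z : (~` S) xi -> s <= ndist xi z + h z.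
  move=> Sxi; have := dist_le_norm nrmP a_neq0 z Sxi.
  rewrite -(fineK (dist_fin_num nrm B b I_gt0 a_neq0 z)) lee_fin => dz.
  by have : s - fine (dist z) <= h z by [rewrite /h le_max lexx]; lra.
have := mass_le_transport measurable_ndist (is_norm_ge0 nrmP)
  PW (measurableC mS) (ltW s0) mh h0 sh.
rewrite PU -EFinM lee_fin -/M => sP.
rewrite -[P S]fineK ?fin_num_measure// lee_fin.
have : s * (1 - fine (P S)) <= s * eps by lra.
by rewrite ler_pM2l//; lra.
Qed.

Lemma Zset_cvar_proper :
  (Zset nrm eta1 eta2 B b P0 delta eps x <->
   ((delta / eps)%:E + cvar P0 eps X <= 0)%E) /\
  exists gamma, cvar P0 eps X = cvar_objective P0 eps X gamma.
Proof.
have [s [t [t01 tsum tmax]]] := quantile_weights d N_gt0 eps_gt0 eps_lt1.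
have [smin sval] := cvar_sum_min N_gt0 eps_gt0 t01 tsum tmax.
have cvarE : cvar P0 eps X = cvar_objective P0 eps X (- s).
  apply/eqP; rewrite eq_le; apply/andP; split.
    by apply: ereal_inf_lbound; exists (- s).
  by apply: le_ereal_inf_tmp => _ [g _ <-]; rewrite !objE lee_fin.
split; last by exists (- s).
rewrite cvarE objE -EFinD lee_fin -(pmulr_rle0 _ eps_gt0) mulrDr sval.
rewrite mulrCA divff ?gt_eqF// mulr1 subr_le0.
split => [|deltaC]; last first.
  by apply: le_ereal_inf_tmp => _ [P PW <-]; exact: (safe_mass_ge t01 tsum tmax).
move=> xZ; rewrite leNgt; apply/negP => /(unsafe_transport t01 tsum)[P PW PS].
have : ((1 - eps)%:E <= P S)%E.
  by apply: le_trans xZ _; apply: ereal_inf_lbound; exists P.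
by rewrite leNgt PS.
Qed.

End proper_constraint.

(** When [avec eta1 eta2 x = 0] the constraints no longer involve the random
    vector: the safe set is everything and [dist] is [+oo], or it is empty and
    [dist] is [0]. *)
Section degenerate_constraint.
Hypothesis a_eq0 : avec eta1 eta2 x = 0.

Let distE z : dist z = \big[mine/+oo%E]_i chi [set y | bfun B b i y < 0] x.
Proof.
rewrite /f /calI a_eq0 eqxx big_pred0; last by move=> i; rewrite inE.
by rewrite minye; apply: eq_bigl => i; rewrite inE.
Qed.

Lemma Zset_cvar_feasible : (forall i, 0 <= bfun B b i x) ->
  Zset nrm eta1 eta2 B b P0 delta eps x /\ cvar P0 eps X = -oo%E.
Proof.
move=> b0; split.
  apply: le_ereal_inf_tmp => _ [P PW <-].
  have -> : S = setT.
    by apply/seteqP; split => // xi _ i; rewrite a_eq0 dot0_block.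
  by rewrite probability_setT lee_fin gerBl ltW.
have XE z : X z = -oo%E.
  rewrite distE big1// => i _; rewrite /chi memNset//=; apply/negP.
  by rewrite -leNgt.
apply/eq_ninfty => g; apply: ereal_inf_lbound; exists g => //.
rewrite /cvar_objective.
under eq_integral do rewrite XE addNye (max_idPr (leNye _)).
by rewrite integral0 mule0 adde0.
Qed.

Lemma Zset_cvar_infeasible i : bfun B b i x < 0 ->
  ~ Zset nrm eta1 eta2 B b P0 delta eps x /\
  cvar P0 eps X = 0%E /\ cvar_objective P0 eps X 0 = 0%E.
Proof.
move=> bi.
have [P PW] := ambiguity_neq0.
have XE z : X z = 0%E.
  rewrite distE; apply/eqP; rewrite oppe_eq0 eq_le; apply/andP; split.
    apply: le_trans (bigmin_le_cond _ _ (isT : xpredT i)) _.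
    by rewrite /chi mem_set.
  apply/bigmin_geP; split => [|k _]; first exact: leey.
  by rewrite /chi; case: ifP => // _; exact: leey.
have objE gamma : cvar_objective P0 eps X gamma =
    (gamma + eps^-1 * Num.max (- gamma) 0)%:E.
  rewrite /cvar_objective.
  under eq_integral do rewrite XE sub0e -EFinN -EFin_max.
  have P0T : P0 setT = 1%E by exact: probability_setT.
  by rewrite integral_cst// [X in (_ + _ * (_ * X))%E]P0T mule1 -EFinM.
have obj0 : cvar_objective P0 eps X 0 = 0%E.
  by rewrite objE oppr0 maxxx mulr0 addr0.
split; last split => //.
  rewrite /Zset/= leNgt => /negP; apply.
  apply: (@le_lt_trans _ _ (P S)); first by apply: ereal_inf_lbound; exists P.
  have -> : S = set0.
    apply/seteqP; split => // xi /(_ i); rewrite a_eq0 dot0_block.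
    by rewrite leNgt bi.
  by rewrite measure0 lte_fin subr_gt0.
apply/eqP; rewrite eq_le; apply/andP; split.
  by rewrite -obj0; apply: ereal_inf_lbound; exists 0.
apply: le_ereal_inf_tmp => _ [g _ <-]; rewrite objE lee_fin.
(* For [g < 0] the objective is [g * (1 - eps^-1)], which is positive. *)
have e1 : 1 < eps^-1 by rewrite invf_gt1.
by have [g0|g0] := leP (- g) 0; nra.
Qed.

Lemma Zset_cvar_degenerate :
  (Zset nrm eta1 eta2 B b P0 delta eps x <->
   ((delta / eps)%:E + cvar P0 eps X <= 0)%E) /\
  (cvar P0 eps X = -oo%E \/
   exists gamma, cvar P0 eps X = cvar_objective P0 eps X gamma).
Proof.
have [b0|/existsNP[i /negP]] := pselect (forall i, 0 <= bfun B b i x).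
  have [xZ ->] := Zset_cvar_feasible b0; split; last by left.
  by rewrite addeNy leNye; split.
rewrite -ltNge => /Zset_cvar_infeasible[xZ [-> obj0]]; split.
  split => //; rewrite adde0 lee_fin leNgt => /negP; case.
  exact: divr_gt0.
by right; exists 0.
Qed.

End degenerate_constraint.

Lemma Zset_cvar :
  (Zset nrm eta1 eta2 B b P0 delta eps x <->
   ((delta / eps)%:E + cvar P0 eps X <= 0)%E) /\
  (cvar P0 eps X = -oo%E \/
   exists gamma, cvar P0 eps X = cvar_objective P0 eps X gamma).
Proof.
have [/Zset_cvar_degenerate//|/Zset_cvar_proper[ZE cvar_min]] :=
  eqVneq (avec eta1 eta2 x) 0.
by split => //; right.
Qed.

End chance_constraint_at.

Theorem corollary1 (R : realType) (n I N : nat)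
  (n_gt0 : (0 < n)%N) (I_gt0 : (0 < I)%N) (N_gt0 : (0 < N)%N)
  (eps delta : R) (eps_gt0 : 0 < eps) (eps_lt1 : eps < 1) (delta_gt0 : 0 < delta)
  (eta1 eta2 : bool) (eta_ge1 : (1 <= eta1 + eta2)%N)
  (B : 'I_I -> 'cV[R]_n) (b : 'I_I -> R)
  (nrm : 'M[R]_(I, n + 1) -> R) (nrm_norm : is_norm nrm)
  (dual_norm_indep : forall (a : 'cV[R]_(n + 1)) (i i' : 'I_I),
    dual_norm nrm i a = dual_norm nrm i' a)
  (zeta : 'I_N -> Xi R I n) :
  let P0 : probability (Xi R I n) R := empirical R zeta N_gt0 in
  let mf (x : 'cV[R]_n) (z : Xi R I n) : \bar R :=
    (- f nrm eta1 eta2 B b x z)%E in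
  Zset nrm eta1 eta2 B b P0 delta eps =
    [set x | ((delta / eps)%:E + cvar P0 eps (mf x) <= 0)%E]
  /\ (* the infimum defining CVaR is a minimum unless it is -oo *)
  (forall x, cvar P0 eps (mf x) = -oo%E \/
     exists gamma : R, cvar P0 eps (mf x) = cvar_objective P0 eps (mf x) gamma).
Proof.
move=> P0 mf.
have key x := Zset_cvar I_gt0 N_gt0 eps_gt0 eps_lt1 delta_gt0 eta1 eta2 B b
  nrm_norm zeta x.
split; last by move=> x; have [_] := key x.
by apply/seteqP; split => x; have [[]] := key x.
Qed.
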